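(* Let $\Lambda\subseteq\mathbb{R}^n$ be a lattice of full rank, let $v_1,\ldots,v_k\in\mathbb{R}^n$ be such that $v_i-v_j\notin\Lambda$ for all $1\le i<j\le k$, and let $V=\bigcup_{i=1}^k(v_i+\Lambda)$. Let $\ell\in\mathbb{N}$, and let $D_1,D_2\subseteq\mathbb{R}^n$ be bounded and Lebesgue-measurable sets such that (i) $\operatorname{vol}(D_1)+\operatorname{vol}(D_2)>\frac{\det(\Lambda)}{k}\,\ell$, and (ii) $\#\left((z+D_i)\cap V\right)\leq\ell$ for $i=1,2$ and every $z\in\mathbb{R}^n$. Then every translate of $D_1-D_2$ contains at least $\ell$ points of $V-V$; that is, $\#\left((t+(D_1-D_2))\cap(V-V)\right)\geq\ell$ for every $t\in\mathbb{R}^n$.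
   Context: A lattice is a discrete subgroup of $\mathbb{R}^n$, always assumed to be of full rank; writing $\Lambda=B\mathbb{Z}^n$ with $B\in\mathbb{R}^{n\times n}$ invertible, its determinant is $\det(\Lambda)=|\det(B)|$. $\operatorname{vol}$ denotes Lebesgue measure, $\#$ denotes cardinality, and for sets $X,Z\subseteq\mathbb{R}^n$ and $t\in\mathbb{R}^n$ we write $X-Z=\{x-z : x\in X, z\in Z\}$ and $t+X=\{t+x : x\in X\}$. Here $k\ge1$ and $n\ge 1$ are integers. *)

(* Defs.v *)
From HB Require Import structures.
From mathcomp Require Import all_boot all_order all_algebra.
From mathcomp Require Import all_classical all_reals all_analysis.
Set Implicit Arguments.
Unset Strict Implicit.
Unset Printing Implicit Defensive.
Import Order.TTheory GRing.Theory Num.Theory.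
Import numFieldNormedType.Exports.
Local Open Scope classical_set_scope.
Local Open Scope ring_scope.

Section SetOperations.
Variables (R : realType) (n : nat).
Implicit Types X Z : set 'cV[R]_n.

Definition translate (t : 'cV[R]_n) X : set 'cV[R]_n := [set t + x | x in X].

Definition diffset X Z : set 'cV[R]_n := [set x - z | x in X & z in Z].

End SetOperations.

Section Lattices.
Variables (R : realType) (n : nat).
Implicit Types L : set 'cV[R]_n.

Definition subgroup L := L 0 /\ forall x y, L x -> L y -> L (x - y).

(* The columns of [M] are [n] linearly independent vectors of [L]. *)
Definition full_rank L :=
  exists2 M : 'M[R]_n, M \in unitmx & forall j, L (col j M).

Definition lattice L := [/\ subgroup L, L `<=` isolated L & full_rank L].

Definition lattice_basis L (B : 'M[R]_n) :=
  B \in unitmx /\ L = range (fun z : 'cV[int]_n => B *m map_mx intr z).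

(* Two bases of [L] differ by a unimodular matrix, so that the value does not
   depend on the basis picked by [xget]; the default [0] is only used for sets
   that have no basis, hence are not lattices. *)
Definition lattice_det L : R := `|\det (xget 0 (lattice_basis L))|.

End Lattices.

Section LebesgueMeasure.
Local Open Scope ereal_scope.
Variables (R : realType) (n : nat).
Implicit Types (a b : 'cV[R]_n) (A : set 'cV[R]_n).

Definition box a b : set 'cV[R]_n :=
  [set x | forall i, x i 0%R \in `[a i 0%R, b i 0%R[].

Definition box_volume a b : R := (\prod_(i < n) (b i 0 - a i 0))%R.

Definition box_cover A : set (nat -> 'cV[R]_n * 'cV[R]_n) :=
  [set F : nat -> 'cV[R]_n * 'cV[R]_n |
    (forall k i, (F k).1 i 0 <= (F k).2 i 0)%R /\
    A `<=` \bigcup_k box (F k).1 (F k).2].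

(* The [n]-dimensional Lebesgue outer measure, for [0 < n] (for [n = 0] no box
   is empty).  It is the Lebesgue measure on the Lebesgue-measurable sets, i.e.,
   on the sets that satisfy the Caratheodory criterion. *)
Definition vol A : \bar R :=
  ereal_inf [set \sum_(k <oo) (box_volume (F k).1 (F k).2)%:E
            | F in box_cover A].

Definition Lebesgue_measurable A := vol.-caratheodory A.

End LebesgueMeasure.

Section LebesgueOuterMeasure.
Local Open Scope ereal_scope.
Variables (R : realType) (n : nat).
Implicit Types A : set 'cV[R]_n.+1.

Let box_volume_ge0 m (a b : 'cV[R]_m) :
  (forall i, a i 0 <= b i 0)%R -> (0 <= box_volume a b)%R.
Proof. by move=> ab; apply: prodr_ge0 => i _; rewrite subr_ge0. Qed.

Let vol_ge0 A : 0 <= vol A.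
Proof.
apply: le_ereal_inf_tmp => x [F [Fle AF] <-{x}].
by apply: nneseries_ge0 => k _ _; rewrite lee_fin box_volume_ge0.
Qed.

Let le_vol : {homo @vol R n.+1 : A B / A `<=` B >-> A <= B}.
Proof.
move=> A B AB; apply/ereal_inf_le_tmp => x [F [Fle BF] <-{x}].
by exists F => //; split => //; exact: subset_trans BF.
Qed.

Let vol0 : vol (@set0 'cV[R]_n.+1) = 0.
Proof.
apply/eqP; rewrite eq_le vol_ge0 andbT.
apply: ereal_inf_lbound; exists (fun=> (0%R, 0%R)).
  by split=> [k i|x []] /=; rewrite lexx.
apply: eseries0 => k _ _ /=.
by rewrite /box_volume big_ord_recl subrr mul0r.
Qed.

Let vol_sigma_subadditive : sigma_subadditive (@vol R n.+1).
Proof.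
move=> A; have [[i ioo]|] := pselect (exists i, vol (A i) = +oo).
  rewrite (eseries_pinfty _ _ ioo) ?leey// => k _.
  by rewrite -ltNye (lt_le_trans _ (vol_ge0 _)).
rewrite -forallNE => Aoo.
suff add2e (e : {posnum R}) :
    vol (\bigcup_k A k) <= \sum_(i <oo) vol (A i) + e%:num%:E.
  by apply/lee_addgt0Pr => _/posnumP[].
rewrite (le_trans _ (epsilon_trick _ _ _))//.
pose bv (p : 'cV[R]_n.+1 * 'cV[R]_n.+1) := (box_volume p.1 p.2)%:E.
pose P k F := box_cover (A k) F /\
  \sum_(j <oo) bv (F j) <= vol (A k) + (e%:num / (2 ^ k.+1)%:R)%:E.
have [G PG] : {G : nat -> nat -> 'cV[R]_n.+1 * 'cV[R]_n.+1 &
    forall k, P k (G k)}.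
  apply: (@choice _ _ P) => k; rewrite /P.
  have vfin : vol (A k) \is a fin_num.
    by rewrite ge0_fin_numE// ltey; apply/eqP.
  have en1 : (0 < e%:num / (2 ^ k.+1)%:R :> R)%R by [].
  have [x [F cF <-] xS] := lb_ereal_inf_adherent en1 vfin.
  by exists F; split => //; exact/ltW.
have bvG_ge0 x : 0 <= (bv \o uncurry G) x.
  by case: x => i j; rewrite lee_fin box_volume_ge0// => l; apply: (PG i).1.1.
apply: (@le_trans _ _ (\esum_(i in setT) (bv \o uncurry G) i)).
  apply: ereal_inf_lbound => /=.
  have /card_esym/ppcard_eqP[f] := card_nat2.
  exists (uncurry G \o f).
    split => [k i|t [i _ /(PG i).1.2 [j _ Gt]]].
      by rewrite /=; case: (f k) => p q; apply: (PG p).1.1.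
    by exists (f^-1%FUN (i, j)) => //=; rewrite invK ?inE.
  rewrite -(esum_pred_image (bv \o uncurry G) _ xpredT) ?[fun=> _]set_true//.
  by rewrite image_eq.
rewrite (_ : esum _ _ = \sum_(i <oo) \sum_(j <oo) bv (G i j)); last first.
  pose J : nat -> set (nat * nat) := fun i => [set (i, j) | j in setT].
  rewrite (_ : setT = \bigcup_k J k); last first.
    by rewrite predeqE => -[a b]; split => // _; exists a => //; exists b.
  rewrite esum_bigcupT//=; last first.
    apply/trivIsetP => i j _ _ ij.
    rewrite predeqE => -[p m] /=; split => //= -[] [_] _ [<-{p} _].
    by move=> [m' _] [] /esym/eqP; rewrite (negbTE ij).
  rewrite -(image_id [set: nat]) -fun_true esum_pred_image//; last first.
    by move=> k _; apply: esum_ge0 => p _; exact: bvG_ge0.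
  apply: eq_eseriesr => /= j _.
  rewrite -(esum_pred_image (bv \o uncurry G) (pair j) predT)//=; last 2 first.
    by move=> p _; exact: (bvG_ge0 (j, p)).
    by move=> ? ? _ _; exact: (@can_inj _ _ _ snd).
  by congr esum; rewrite predeqE => -[a b]; split; move=> [i _ <-]; exists i.
apply: lee_nneseries => [i _ _|i _]; last exact: (PG i).2.
by apply: nneseries_ge0 => j _ _; exact: (bvG_ge0 (i, j)).
Qed.

HB.instance Definition _ := isOuterMeasure.Build R 'cV[R]_n.+1 (@vol R n.+1)
  vol0 vol_ge0 le_vol vol_sigma_subadditive.

End LebesgueOuterMeasure.

(* Main.v *)
(** Were every translate pair to satisfy #((z+t+D1) n V) + #((z+D2) n V) <= l,
    averaging would give vol D1 + vol D2 <= l det(L) / k; so some z gives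
    A = (z+t+D1) n V and B = (z+D2) n V with #A + #B > l. By (ii) both are
    nonempty, and A - B, which lies in (t + (D1-D2)) n (V-V), has at least
    #A + #B - 1 >= l elements.

    The averaging is over the points of V in a large box instead of over a
    fundamental domain, so that no change of variables for [vol] is needed: all
    that enters is that [vol] is an outer measure, that it is invariant under
    translation, that a box has volume at most its product of sides, and a lower
    bound for the number of lattice points in a suitable box. The latter comes
    from an LU decomposition of a basis and boxes with sides of increasing
    orders of magnitude. *)
Require Import Defs.
From mathcomp Require Import all_boot all_order all_algebra.
From mathcomp Require Import all_classical all_reals all_analysis.
From mathcomp Require Import perm ring lra.
Set Implicit Arguments.
Unset Strict Implicit.
Unset Printing Implicit Defensive.
Import Order.TTheory GRing.Theory Num.Theory.
Import numFieldNormedType.Exports.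
Local Open Scope classical_set_scope.
Local Open Scope ring_scope.

(** * Duplicate-free sequences and cardinal bounds *)

Lemma uniq_card_le (T : eqType) (s : seq T) (S : set T) :
  uniq s -> (forall x, x \in s -> S x) -> (`I_(size s) #<= S)%card.
Proof.
case: s => [_ _|x0 s us sS]; first by rewrite II0 card_ge0.
set h := nth x0 (x0 :: s).
have hinj : {in `I_(size (x0 :: s)) &, injective h}.
  by move=> i j /set_mem/= ilt /set_mem/= jlt /eqP; rewrite nth_uniq// => /eqP.
rewrite -(card_le_eql (inj_card_eq hinj)); apply: subset_card_le.
by move=> _ [i /= ilt <-]; apply: sS; exact: mem_nth.
Qed.

Lemma card_le_uniq (T : eqType) (s : seq T) (S : set T) l :
  uniq s -> (forall x, x \in s -> S x) -> (S #<= `I_l)%card -> (size s <= l)%N.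
Proof.
move=> us sS Sl; rewrite -card_le_II (card_le_trans _ Sl)//.
exact: uniq_card_le.
Qed.

(** * Size of a difference set in Euclidean space *)

Section Sumset.
Variables (R : realType) (n : nat).
Implicit Types (x y a b : 'cV[R]_n).

Definition dot x y : R := \sum_i x i 0 * y i 0.

Lemma dotB x y z : dot (x - y) z = dot x z - dot y z.
Proof.
rewrite /dot -sumrB; apply: eq_bigr => i _; rewrite !mxE /=; ring.
Qed.

(** Expand |a0 - x|^2 > 0 and use |x| <= |a0|. The strictness keeps the two families of differences
    below apart. *)
Lemma dot_lt a0 x : dot x x <= dot a0 a0 -> x != a0 -> dot x a0 < dot a0 a0.
Proof.
move=> xa xna.
have : 0 < dot (a0 - x) (a0 - x).
  rewrite lt_neqAle sumr_ge0 ?andbT; last by move=> i _; rewrite -expr2 sqr_ge0.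
  apply: contra xna => /eqP/esym/psumr_eq0P H; apply/eqP/colP => i.
  have /eqP := H (fun i _ => sqr_ge0 _) i isT.
  by rewrite mulf_eq0 orbb !mxE subr_eq0 => /eqP.
have -> : dot (a0 - x) (a0 - x) = dot a0 a0 + dot x x - 2 * dot x a0.
  rewrite /dot mulr_sumr -big_split -sumrB; apply: eq_bigr => i _.
  rewrite !mxE /=; ring.
lra.
Qed.

(* Take [a0] of maximal norm in A and [b0] in B maximizing <., a0>. The
   differences [a0 - b] for b in B and [a - b0] for [a] in A, [a != a0], are
   pairwise distinct. *)
Lemma card_diff_ge (J : finType) (p : J -> 'cV[R]_n) (A B : pred J)
    (S : set 'cV[R]_n) l :
  injective p -> (forall i j, i \in A -> j \in B -> S (p i - p j)) ->
  (0 < #|A|)%N -> (0 < #|B|)%N -> (l < #|A| + #|B|)%N ->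
  (`I_l #<= S)%card.
Proof.
move=> pinj pS /card_gt0P[i0 i0A] /card_gt0P[j0 j0B] lAB.
case: (@arg_maxP _ R _ i0 A (fun i => dot (p i) (p i)) i0A).
move=> a aA amax; have {}aA : a \in A by [].
case: (@arg_maxP _ R _ j0 B (fun i => dot (p i) (p a)) j0B).
move=> b bB bmax; have {}bB : b \in B by [].
pose s := [seq p a - p j | j <- enum B] ++
          [seq p i - p b | i <- enum [predD1 A & a]].
have ss : (l <= size s)%N.
  rewrite size_cat !size_map -!cardE.
  by move: lAB; rewrite (cardD1 a A) aA addnC addnA addn1.
apply: (@card_le_trans _ _ _ `I_(size s)); first by rewrite card_le_II.
apply: uniq_card_le => [|x]; last first.
  rewrite mem_cat => /orP[] /mapP[j]; rewrite mem_enum => jin ->.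
    exact: pS.
  by apply: pS => //; move: jin; rewrite !inE => /andP[].
rewrite cat_uniq !map_inj_uniq ?enum_uniq//=; last 2 first.
- by move=> i j /addIr/pinj.
- by move=> i j /addrI/oppr_inj/pinj.
rewrite andbT; apply/hasPn => x /mapP[i].
rewrite mem_enum !inE => /andP[ia iA] ->.
(* A coincidence [p i - p b = p a - p j], paired with [p a], would give <p i, p a> + <p j, p a> = <p
   a, p a> + <p b, p a>. This is impossible, since the first summand is strictly smaller and the
   second is not larger. *)
apply/negP => /mapP[j]; rewrite mem_enum => jB /(congr1 (dot ^~ (p a))).
rewrite /= !dotB => e.
have : dot (p i) (p a) < dot (p a) (p a).
  by apply: dot_lt; [exact: amax | rewrite (inj_eq pinj)].
have /= : dot (p j) (p a) <= dot (p b) (p a) := bmax _ jB.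
lra.
Qed.

End Sumset.

(** * Covering multiplicity for an outer measure *)

Section Multiplicity.
Local Open Scope ereal_scope.

(** An integration-free form of bounding the integral over [X] of the sum of the indicators of the
    [E j]. Induction on [s] cuts [X] along the head set; [X] stays arbitrary so that the induction
    hypothesis applies to both pieces. *)
Lemma caratheodory_multiplicity (R : realType) (T : Type)
    (mu : {outer_measure set T -> \bar R}) (J : eqType) (s : seq J)
    (E : J -> set T) (l : nat) (X : set T) :
  (forall j, j \in s -> mu.-caratheodory (E j)) ->
  (forall x, X x -> (count (fun j => `[< E j x >]) s <= l)%N) ->
  \sum_(j <- s) mu (X `&` E j) <= l%:R%:E * mu X.
Proof.
elim: s l X => [|j s IH] l X cE Xl.
  by rewrite big_nil mule_ge0 ?lee_fin ?outer_measure_ge0.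
have cEs i : i \in s -> mu.-caratheodory (E i).
  by move=> si; apply: cE; rewrite inE si orbT.
have cEj : mu.-caratheodory (E j) by apply: cE; rewrite inE eqxx.
have le2 : \sum_(i <- s) mu (X `&` ~` E j `&` E i) <=
    l%:R%:E * mu (X `&` ~` E j).
  apply: IH => // x [Xx nEx]; have := Xl _ Xx; rewrite /=.
  by move: nEx => /asboolPn/negbTE ->.
rewrite big_cons [X in _ <= _ * X](cEj X).
rewrite ge0_muleDr ?outer_measure_ge0//.
have -> : \sum_(i <- s) mu (X `&` E i) =
    \sum_(i <- s) mu (X `&` E j `&` E i) +
    \sum_(i <- s) mu (X `&` ~` E j `&` E i).
  rewrite -big_split/=; apply: eq_bigr => i _.
  by rewrite [LHS](cEj (X `&` E i)); congr (mu _ + mu _); rewrite setIAC.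
rewrite addeA; apply: leeD le2.
(* Inside [E j] the head counts once, so the remaining sets have multiplicity at most [l - 1] there;
   for [l = 0] this piece is empty. *)
case: l Xl {IH} (IH l.-1 (X `&` E j) cEs) => [|l] Xl IH.
  suff -> : X `&` E j = set0.
    rewrite outer_measure0 mule0 add0e big1// => i _.
    by rewrite set0I outer_measure0.
  apply/seteqP; split => // x [Xx Ex]; have := Xl x Xx => /=.
  by rewrite asboolT.
rewrite -natr1 EFinD ge0_muleDl ?lee_fin// mul1e addeC leeD2r//.
apply: IH => x [Xx Ex]; have := Xl _ Xx; rewrite /= asboolT//.
Qed.

End Multiplicity.

(** * Translation invariance and packing in a box *)

Section Volume.
Variables (R : realType).

Lemma vol_translate n (X : set 'cV[R]_n) (s : 'cV[R]_n) :
  vol [set w | X (w + s)] = vol X.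
Proof.
have le_vol (Y : set 'cV[R]_n) u : (vol [set w | Y (w + u)%R] <= vol Y)%E.
  apply/ereal_inf_le_tmp => _ [F [Fle YF] <-].
  exists (fun k => ((F k).1 - u, (F k).2 - u)); first split.
  - by move=> k i; rewrite !mxE lerD2r.
  - move=> w /= /YF[k _ Fk]; exists k => // i; have := Fk i.
    by rewrite /= !in_itv/= !mxE lerBlDr ltrBrDr.
  - apply: eq_eseriesr => k _; congr (_%:E); apply: eq_bigr => i _.
    by rewrite !mxE opprB addrA subrK.
apply/eqP; rewrite eq_le le_vol andTb.
have := le_vol [set w | X (w + s)] (- s).
by under [X in vol X]eq_set do rewrite /= addrNK.
Qed.

Lemma caratheodory_translate n (E : set 'cV[R]_n) (s : 'cV[R]_n) :
  Lebesgue_measurable E -> Lebesgue_measurable [set w | E (w + s)].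
Proof.
move=> mE X; rewrite -(vol_translate X (- s)) mE.
rewrite -[vol (X `&` _)](vol_translate _ (- s)).
rewrite -[vol (X `&` ~` _)](vol_translate _ (- s)).
by congr (_ + _)%E; congr vol; apply/seteqP; split=> w /=; rewrite addrNK.
Qed.

Lemma vol_box_le n (a b : 'cV[R]_n.+1) : (forall i, a i 0 <= b i 0) ->
  (vol (box a b) <= (box_volume a b)%:E)%E.
Proof.
move=> ab; apply: ereal_inf_lbound.
(* The degenerate boxes that complete the countable cover have volume zero because the dimension is
   positive. *)
pose F k : 'cV[R]_n.+1 * 'cV[R]_n.+1 := if k is 0%N then (a, b) else (0, 0).
have Fle k i : (F k).1 i 0 <= (F k).2 i 0 by case: k => //=.
exists F; first by split => // x ?; exists 0%N.
rewrite (nneseries_split 0 1); last first.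
  move=> k _; rewrite lee_fin; apply: prodr_ge0 => i _.
  by rewrite subr_ge0.
rewrite add0n big_nat1 eseries0 ?adde0// => -[//|k] _ _ /=.
by rewrite /box_volume big_ord_recl subrr mul0r.
Qed.

(** All translates, indexed by [J + J], lie in the box and cover none of its points more than [l]
    times, so the multiplicity bound applies with the box as [X]. *)
Lemma packing_bound n (J : finType) (D1 D2 : set 'cV[R]_n.+1)
    (q1 q2 : J -> 'cV[R]_n.+1) (a b : 'cV[R]_n.+1) (l : nat) :
  Lebesgue_measurable D1 -> Lebesgue_measurable D2 ->
  (forall i, a i 0 <= b i 0) ->
  (forall j w, D1 (w + q1 j) -> box a b w) ->
  (forall j w, D2 (w + q2 j) -> box a b w) ->
  (forall w, #|[pred j | `[< D1 (w + q1 j)%R >]]|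
             + #|[pred j | `[< D2 (w + q2 j)%R >]]| <= l)%N ->
  (#|J|%:R%:E * (vol D1 + vol D2) <= (l%:R * box_volume a b)%:E)%E.
Proof.
move=> mD1 mD2 ab D1box D2box le_l.
pose E (x : J + J) : set 'cV[R]_n.+1 :=
  match x with
  | inl j => [set w | D1 (w + q1 j)]
  | inr j => [set w | D2 (w + q2 j)]
  end.
pose s : seq (J + J) := map inl (enum J) ++ map inr (enum J).
have mE j : j \in s -> (@vol R n.+1).-caratheodory (E j).
  by case: j => j _; exact: caratheodory_translate.
have Ebox j : box a b `&` E j = E j.
  by apply/setIidr; case: j => j w /=; [exact: D1box | exact: D2box].
rewrite EFinM; apply: le_trans (lee_pmul _ _ (lexx _) (vol_box_le ab));
  rewrite ?lee_fin ?(outer_measure_ge0 (@vol R n.+1))//.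
apply: le_trans (caratheodory_multiplicity mE _); last first.
  move=> w _; apply: leq_trans (le_l w).
  have cnt (P : pred J) : count P (enum J) = #|[pred j | P j]|.
    rewrite -sum1_count big_enum_cond -sum1_card.
    by apply: eq_bigl => j; rewrite inE.
  by rewrite count_cat (count_map inl) (count_map inr) !cnt.
rewrite big_cat (big_map inl) (big_map inr) !big_enum/=.
rewrite (eq_bigr (fun=> vol D1)) => [|j _]; last first.
  by rewrite (Ebox (inl j)) /= vol_translate.
rewrite [X in (_ <= _ + X)%E](eq_bigr (fun=> vol D2)) => [|j _]; last first.
  by rewrite (Ebox (inr j)) /= vol_translate.
rewrite !sumr_const ge0_muleDr ?(outer_measure_ge0 (@vol R n.+1))//.
by rewrite !mule_natl.
Qed.

End Volume.

(** * Existence of lattice bases *)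

Section LatticeBasis.
Variables (R : realType) (n : nat).
Implicit Types (L : set 'cV[R]_n) (M : 'M[R]_n).

Section Subgroup.
Variables (L : set 'cV[R]_n) (sL : subgroup L).

Lemma subgroupN x : L x -> L (- x).
Proof. by case: sL => L0 LB Lx; rewrite -sub0r; exact: LB. Qed.

Lemma subgroupD x y : L x -> L y -> L (x + y).
Proof.
by move=> Lx Ly; rewrite -[y]opprK; apply: sL.2 => //; exact: subgroupN.
Qed.

Lemma subgroupMn x k : L x -> L (x *+ k).
Proof.
move=> Lx; elim: k => [|k IH]; first by rewrite mulr0n; case: sL.
by rewrite mulrS; exact: subgroupD.
Qed.

Lemma subgroupMz x z : L x -> L (x *~ z).
Proof.
move=> Lx; case: z => k; first exact: subgroupMn.
by apply: subgroupN; exact: subgroupMn.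
Qed.

Lemma subgroup_mulmx (M : 'M[R]_n) (z : 'cV[int]_n) :
  (forall j, L (col j M)) -> L (M *m map_mx intr z).
Proof.
move=> LM.
have -> : M *m map_mx intr z = \sum_j col j M *~ z j 0.
  apply/colP => i; rewrite !mxE summxE; apply: eq_bigr => j _.
  by rewrite -scaler_int !mxE mulrC.
elim/big_ind: _ => [|x y|j _]; first by case: sL.
  exact: subgroupD.
exact: subgroupMz.
Qed.

End Subgroup.

Lemma isolated0_gap L : isolated L 0 ->
  exists2 e : R, 0 < e & forall x, L x -> (forall i, `|x i 0| < e) -> x = 0.
Proof.
case=> _ [W /nbhs_ballP[e /= e0 eW] WL]; exists e => // x Lx xe.
suff : (W `&` L) x by rewrite WL.
split => //; apply: eW; split => // i j; rewrite (ord1 j) mxE.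
by rewrite /ball/= sub0r normrN.
Qed.

(* Dirichlet's simultaneous approximation, by the pigeonhole principle *)
Lemma simultaneous_approx (c : 'cV[R]_n) (q : nat) : (0 < q)%N ->
  exists j, (0 < j <= q ^ n)%N /\
    exists z : 'cV[int]_n, forall i, `|j%:R * c i 0 - (z i 0)%:~R| < q%:R^-1.
Proof.
case: q => // q _.
pose fr (k : nat) i := k%:R * c i 0 - (Num.floor (k%:R * c i 0))%:~R.
have fr01 k i : 0 <= fr k i < 1.
  rewrite /fr; have /andP[] := floor_itv (k%:R * c i 0).
  rewrite intrD; lra.
(* [f k] is the cell of side 1 / [q.+1] that holds the fractional parts of [k] times [c]. There is
   one more multiple than there are cells. *)
pose f (k : 'I_(q.+1 ^ n).+1) : {ffun 'I_n -> 'I_q.+1} :=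
  [ffun i => inord (Num.truncn (q.+1%:R * fr k i))].
have /injectivePn[k1 [k2 k12 fk]] : ~~ injectiveb f.
  apply/negP => /injectiveP/leq_card.
  by rewrite card_ord card_ffun !card_ord ltnn.
wlog lt12 : k1 k2 k12 fk / (k1 < k2)%N.
  move=> W; case: (ltngtP k1 k2) => h; first exact: (W k1 k2).
    by apply: (W k2 k1) => //; rewrite eq_sym.
  by move/val_inj/eqP: h; rewrite (negbTE k12).
exists (k2 - k1)%N; split.
  by rewrite subn_gt0 lt12 (leq_trans (leq_subr _ _))// -ltnS.
exists (\col_i (Num.floor (k2%:R * c i 0) - Num.floor (k1%:R * c i 0))) => i.
rewrite mxE natrB 1?ltnW// intrB.
have -> : (k2%:R - k1%:R) * c i 0 - ((Num.floor (k2%:R * c i 0))%:~R -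
   (Num.floor (k1%:R * c i 0))%:~R) = fr k2 i - fr k1 i.
  by rewrite /fr mulrBl; ring.
have q0 : 0 < q.+1%:R :> R by rewrite ltr0n.
have tr (k : 'I_(q.+1 ^ n).+1) :
    ((f k i : nat)%:R <= q.+1%:R * fr k i :> R) /\
    (q.+1%:R * fr k i < (f k i : nat)%:R + 1 :> R).
  have /andP[k0 k1'] := fr01 k i.
  have qk0 : 0 <= q.+1%:R * fr k i by rewrite mulr_ge0// ltW.
  rewrite ffunE inordK; last first.
    by rewrite truncn_lt_nat// -[ltRHS]mulr1 ltr_pM2l.
  have /andP[] := truncn_itv qk0.
  by rewrite natr1.
have [a1 a2] := tr k1; have [] := tr k2; rewrite -fk => b1 b2.
rewrite -(@ltr_pM2l _ q.+1%:R)// mulfV ?gt_eqF// -[X in X * _](gtr0_norm q0).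
rewrite -normrM mulrBr ltr_norml; apply/andP; split; lra.
Qed.

(** Some multiple of [x] by a positive [j <= q ^ n] is so close to an integer combination of the
    columns of [M] that the gap around 0 forces equality. As [q] depends only on [M] and the gap,
    the factorial of [q ^ n] clears the denominators for all [x] at once. *)
Lemma lattice_exponent L M : subgroup L -> isolated L 0 -> M \in unitmx ->
  (forall j, L (col j M)) ->
  exists2 N, (0 < N)%N & forall x, L x ->
    forall i, N%:R * (invmx M *m x) i 0 \is a Num.int.
Proof.
move=> sL /isolated0_gap[e e0 gap] uM LM.
pose S := \sum_i \sum_j `|M i j|.
have S0 : 0 <= S by apply: sumr_ge0 => i _; apply: sumr_ge0.
pose q := (Num.truncn (S / e)).+1.
have q0 : 0 < q%:R :> R by rewrite ltr0n.
have Sq : S / q%:R < e.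
  by rewrite ltr_pdivrMr// mulrC -ltr_pdivrMr//; exact: truncnS_gt.
exists (q ^ n)`!; first exact: fact_gt0.
move=> x Lx i; set c := invmx M *m x.
have [j [j0q [z zc]]] := @simultaneous_approx c q isT.
suff jc : j%:R * c i 0 = (z i 0)%:~R.
  have /dvdnP[d ->] := dvdn_fact j0q.
  by rewrite natrM -mulrA jc rpredM ?rpred_nat ?rpred_int// intr_int.
have : x *+ j - M *m map_mx intr z = 0.
  apply: gap => [|k].
    by apply: sL.2; [exact: subgroupMn|exact: subgroup_mulmx].
  have -> : x *+ j - M *m map_mx intr z = M *m (j%:R *: c - map_mx intr z).
    by rewrite mulmxBr -scalemxAr mulKVmx// scaler_nat.
  have MS : \sum_j `|M k j| <= S.
    rewrite /S [leRHS](bigD1 k)//= lerDl; apply: sumr_ge0 => ? _.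
    exact: sumr_ge0.
  apply: le_lt_trans Sq; apply: (@le_trans _ _ ((\sum_j `|M k j|) / q%:R)).
    rewrite mxE; apply: le_trans (ler_norm_sum _ _ _) _.
    rewrite mulr_suml; apply: ler_sum => m _; rewrite normrM ler_wpM2l// !mxE.
    by move: (ltW (zc m)); rewrite !mxE.
  by rewrite ler_pM2r// invr_gt0.
move/subr0_eq/(congr1 (mulmx (invmx M))); rewrite mulKmx// => /colP/(_ i).
by rewrite -scaler_nat -scalemxAr !mxE.
Qed.

(** Cramer's rule; it measures how exchanging one basis vector changes the determinant. *)
Lemma det_replace_col M (i : 'I_n) (y : 'cV[R]_n) : M \in unitmx ->
  \det (\matrix_(a, b) if b == i then y a 0 else M a b) =
  \det M * (invmx M *m y) i 0.
Proof.
move=> uM; rewrite /invmx uM -scalemxAl mxE mulrA divff -?unitfE// mul1r.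
rewrite (expand_det_col _ i) mxE; apply: eq_bigr => a _.
rewrite !mxE eqxx mulrC; congr (_ * _); rewrite /cofactor; congr (_ * \det _).
by apply/matrixP => b d; rewrite !mxE eq_sym (negbTE (neq_lift _ _)).
Qed.

(* A family of n vectors of L with smallest nonzero determinant is a basis:
   otherwise reducing the coordinates of some vector of L modulo 1 and
   exchanging it with a member of the family would decrease the determinant. *)
Lemma lattice_has_basis L : lattice L -> exists B, lattice_basis L B.
Proof.
case=> sL isoL [M uM LM].
have [N N0 Nint] := lattice_exponent sL (isoL _ sL.1) uM LM.
(* With this factor, |det X| c is the absolute determinant of the integer matrix N M^-1 X. Hence a
   least nonzero determinant can be found among natural numbers. *)
pose c := N%:R ^+ n / `|\det M|.
have detM0 : 0 < `|\det M| by rewrite normr_gt0 -unitfE.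
have c0 : 0 < c by rewrite divr_gt0// exprn_gt0// ltr0n.
have natc X : (forall j, L (col j X)) -> exists d : nat, `|\det X| * c = d%:R.
  move=> LX; pose A := N%:R *: (invmx M *m X).
  have Aint i j : A i j \is a Num.int.
    have := Nint _ (LX j) i; rewrite !mxE.
    by under eq_bigr do rewrite mxE.
  have : A = map_mx intr (map_mx Num.floor A).
    by apply/matrixP => i j; rewrite [RHS]mxE [X in _ = X%:~R]mxE floorK.
  move/(congr1 determinant); rewrite det_map_mx detZ det_mulmx det_inv.
  move/(congr1 Num.norm); rewrite -intr_norm => e.
  exists `|\det (map_mx Num.floor A)|%N; rewrite natr_absz -e /c.
  by rewrite !normrM normfV normrX normr_nat; ring.
pose P d := `[< exists X, [/\ forall j, L (col j X), X \in unitmx &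
                 `|\det X| * c = d%:R] >].
have exP : exists d, P d.
  by have [d dM] := natc M LM; exists d; apply/asboolP; exists M.
case: (ex_minnP exP) => d /asboolP[X [LX uX Xd]] dmin.
exists X; split => //; apply/seteqP; split=> [x Lx|_ [z _ <-]]; last first.
  exact: subgroup_mulmx.
pose z : 'cV[int]_n := map_mx Num.floor (invmx X *m x).
pose y := x - X *m map_mx intr z.
have Ly : L y by apply: sL.2 => //; exact: subgroup_mulmx.
have yE i : (invmx X *m y) i 0 =
    (invmx X *m x) i 0 - (Num.floor ((invmx X *m x) i 0))%:~R.
  by rewrite mulmxBr mulKmx// !mxE.
suff y0 i : (invmx X *m y) i 0 = 0.
  exists z => //; apply/esym/eqP; rewrite -subr_eq0 -/y; apply/eqP.
  rewrite -[y](mulKVmx uX); suff -> : invmx X *m y = 0 by rewrite mulmx0.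
  by apply/colP => i; rewrite y0 mxE.
apply/eqP/negPn/negP => yi0.
have /andP[yi_ge0 yi_lt1] : 0 <= (invmx X *m y) i 0 < 1.
  rewrite yE; have /andP[] := floor_itv ((invmx X *m x) i 0).
  rewrite intrD; lra.
have yi_gt0 : 0 < (invmx X *m y) i 0 by rewrite lt_neqAle eq_sym yi0.
pose X' := \matrix_(a, b) if b == i then y a 0 else X a b.
have detX' : \det X' = \det X * (invmx X *m y) i 0 by exact: det_replace_col.
have LX' j : L (col j X').
  have -> : col j X' = if j == i then y else col j X.
    by apply/colP => a; rewrite mxE [LHS]mxE; case: (j == i); rewrite ?mxE.
  by case: (j == i).
have [d' dX'] := natc X' LX'.
have : (d <= d')%N.
  apply: dmin; apply/asboolP; exists X'; split => //.
  rewrite unitmxE detX' unitfE; apply: mulf_neq0 => //.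
  by rewrite -unitfE -unitmxE.
apply/negP; rewrite -ltnNge -(ltr_nat R) -dX' -Xd detX' normrM.
rewrite ltr_pM2r// (gtr0_norm yi_gt0) -[ltRHS]mulr1 ltr_pM2l//.
by rewrite normr_gt0 -unitfE -unitmxE.
Qed.

End LatticeBasis.

(** * Counting lattice points in boxes *)

Section LatticePoints.
Variable R : realType.

(** Back substitution from the last row upwards: changing entry i of [z] moves coordinate i by
    multiples of [U i i] and leaves all later coordinates fixed. *)
Lemma upper_triangular_reduction n (U : 'M[R]_n) (x : 'cV[R]_n) :
  (forall i j : 'I_n, (j < i)%N -> U i j = 0) -> (forall i, U i i != 0) ->
  exists z : 'cV[int]_n, forall i,
    x i 0 <= (U *m map_mx intr z) i 0 < x i 0 + `|U i i|.
Proof.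
move=> Uup Ud.
suff H d : exists z : 'cV[int]_n, forall i : 'I_n, (n - d <= i)%N ->
    x i 0 <= (U *m map_mx intr z) i 0 < x i 0 + `|U i i|.
  by have [z zP] := H n; exists z => i; apply: zP; rewrite subnn.
elim: d => [|d [z zP]].
  by exists 0 => i; rewrite subn0 leqNgt ltn_ord.
have [nd|dn] := leqP n d.
  exists z => i _; apply: zP.
  by move: nd; rewrite -subn_eq0 => /eqP ->.
have i0P : (n - d.+1 < n)%N by rewrite ltn_subrL/= (leq_trans _ dn).
pose i0 := Ordinal i0P.
set y := (U *m map_mx intr z) i0 0 in zP *.
have u0 : 0 < `|U i0 i0| by rewrite normr_gt0.
pose t := (x i0 0 - y) / `|U i0 i0|.
(* The sign of the pivot goes into [q], so that coordinate [i0] changes by [Num.ceil t] times the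
   absolute value of the pivot. *)
pose q : int := Num.ceil t * (if 0 < U i0 i0 then 1 else -1).
have qE : q%:~R * U i0 i0 = (Num.ceil t)%:~R * `|U i0 i0|.
  rewrite /q intrM -mulrA; congr (_ * _).
  case: ltP => [/gtr0_norm ->|/ler0_norm ->]; first by rewrite mul1r.
  by rewrite mulrN1z mulN1r.
pose z' := z + q *: delta_mx i0 0.
have z'E i : (U *m map_mx intr z') i 0 =
    (U *m map_mx intr z) i 0 + q%:~R * U i i0.
  have -> : map_mx intr z' = map_mx intr z + q%:~R *: delta_mx i0 0 :> 'cV[R]_n.
    by apply/colP => k; rewrite !mxE intrD intrM; case: (k == i0).
  by rewrite mulmxDr -scalemxAr -colE !mxE.
exists z' => i; rewrite leq_eqVlt => /orP[/eqP ii0|lti]; last first.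
  rewrite z'E Uup ?mulr0 ?addr0//; apply: zP.
  by rewrite -(subnSK dn).
have -> : i = i0 by exact/val_inj.
rewrite z'E qE -/y.
have /andP[] := ceil_itv t.
have tE : x i0 0 = y + t * `|U i0 i0| by rewrite divfK ?gt_eqF// addrC subrK.
rewrite intrB => t1 t2; rewrite tE lerD2l ler_pM2r// t2/=.
rewrite -addrA ltrD2l -{3}[`|_|]mul1r -mulrDl ltr_pM2r//.
by rewrite -ltrBlDr.
Qed.

(* With B = P^-1 Lo U, the strictly lower part of Lo perturbs a coordinate by
   multiples of the preceding ones only; these are of a smaller order of
   magnitude since the box has sides M, M^2, ..., M^n up to constants. *)
Lemma lattice_points_box n (B : 'M[R]_n.+1) : B \in unitmx ->
  exists (s : 'S_n.+1) (u : 'I_n.+1 -> R) (K : R),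
  [/\ forall i, 0 < u i, \prod_i u i = `|\det B|, 0 <= K &
    forall M, (0 < M)%N -> exists (C : finType) (z : C -> 'cV[int]_n.+1),
    [/\ injective z, #|C| = (\prod_(i < n.+1) M ^ i.+1)%N &
      forall c (i : 'I_n.+1),
        - (K * M%:R ^+ i) <= (B *m map_mx intr (z c)) (s i) 0 <=
          u i * M%:R ^+ i.+1 + K * M%:R ^+ i]].
Proof.
move=> uB.
have := cormen_lup_correct B; have := cormen_lup_perm B.
have := cormen_lup_detL B.
have := @cormen_lup_lower _ _ B; have := @cormen_lup_upper _ _ B.
case: cormen_lup => -[P Lo] U /= Uup Lolow detLo /existsP[s /eqP ->{P}] PB.
have detU : \det U = \prod_i U i i.
  rewrite -det_tr det_trig; first by apply: eq_bigr => i _; rewrite mxE.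
  by apply/is_trig_mxP => i j ij; rewrite mxE Uup.
have detBU : `|\det B| = \prod_i `|U i i|.
  rewrite -normr_prod -detU.
  have /(congr1 (Num.norm \o determinant)) /= := PB.
  by rewrite !det_mulmx detLo mul1r det_perm normrM normr_sign mul1r.
have Ud i : U i i != 0.
  have : \prod_i `|U i i| != 0 by rewrite -detBU normr_eq0 -unitfE -unitmxE.
  by move=> /prodf_neq0/(_ i isT); rewrite normr_eq0.
pose u i := `|U i i|.
have u0 i : 0 < u i by rewrite normr_gt0.
pose K := \sum_i \sum_j `|Lo i j| * u j.
have K0 : 0 <= K.
  by apply: sumr_ge0 => i _; apply: sumr_ge0 => j _; rewrite mulr_ge0// ltW.
exists s, u, K; split => // M M0.
(* Each [c] selects the corner with coordinates [c i * u i]. The half-open cells at these corners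
   are disjoint, which makes [z] injective. *)
pose C : finType := {dffun forall i : 'I_n.+1, 'I_(M ^ i.+1)}.
have red (c : C) := @upper_triangular_reduction _ U
  (\col_i ((c i : nat)%:R * u i)) (fun i j => @Uup i j) Ud.
have [z zP] := choice red.
have {}zP (c : C) i : (c i : nat)%:R * u i <= (U *m map_mx intr (z c)) i 0 <
    (c i : nat).+1%:R * u i.
  by have := zP c i; rewrite mxE -/(u i) -natr1 mulrDl mul1r.
exists C, z; split.
- have le c c' : z c = z c' -> forall i, (c i <= c' i)%N.
    move=> zc i; have /andP[h _] := zP c i; have /andP[_ h'] := zP c' i.
    rewrite -zc in h'; have := le_lt_trans h h'.
    by rewrite ltr_pM2r// ltr_nat ltnS.
  move=> c c' zc; apply/ffunP => i; apply/val_inj/eqP.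
  by rewrite eqn_leq !le.
- rewrite card_dep_ffun foldrE big_map big_enum/=.
  by apply: eq_bigr => i _; rewrite card_ord.
move=> c i; set y := U *m map_mx intr (z c).
have y01 j : 0 <= y j 0 <= u j * M%:R ^+ j.+1.
  have /andP[h1 h2] := zP c j; apply/andP; split.
    by apply: le_trans h1; rewrite mulr_ge0// ltW.
  apply: (le_trans (ltW h2)); rewrite mulrC ler_pM2l// -natrX ler_nat.
  exact: ltn_ord.
have -> : (B *m map_mx intr (z c)) (s i) 0 = (Lo *m y) i 0.
  have -> : Lo *m y = row_perm s (B *m map_mx intr (z c)).
    by rewrite row_permE mulmxA [perm_mx s *m B]PB -mulmxA.
  by rewrite [RHS]mxE.
rewrite mxE (bigD1 i)//= Lolow// eqxx mul1r.
set r := \sum_(j | _) _.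
have rK : `|r| <= K * M%:R ^+ i.
  apply: le_trans (ler_norm_sum _ _ _) _.
  have KE : \sum_j `|Lo i j| * u j <= K.
    rewrite /K [leRHS](bigD1 i)//= lerDl; apply: sumr_ge0 => k _.
    by apply: sumr_ge0 => j _; rewrite mulr_ge0// ltW.
  apply: (le_trans _ (ler_wpM2r _ KE)); last by rewrite exprn_ge0.
  rewrite [X in _ <= X * _](bigD1 i)//= mulrDl ler_wpDl//.
    by rewrite !mulr_ge0 ?exprn_ge0// ltW.
  rewrite mulr_suml; apply: ler_sum => j ji; have [ij|ij] := leqP i j.
    by rewrite Lolow// eq_sym (negbTE ji) normr0 !mul0r normr0.
  rewrite normrM -mulrA ler_wpM2l//.
  have /andP[y0 y1] := y01 j; rewrite ger0_norm// (le_trans y1)// ler_pM2l//.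
  by rewrite ler_weXn2l// ler1n.
have /andP[y0 y1] := y01 i.
move: rK; rewrite ler_norml => /andP[r1 r2]; apply/andP; split; lra.
Qed.

End LatticePoints.

(** * Perturbed products and coordinate bounds *)

Lemma prodrD_lt (R : realType) n (u : 'I_n -> R) (y : R) : \prod_i u i < y ->
  exists2 d : R, 0 < d & forall e, 0 <= e < d -> \prod_i (u i + e) < y.
Proof.
(* As a polynomial in the perturbation, the product is continuous at 0. *)
move=> uy; pose p : {poly R} := \prod_i ((u i)%:P + 'X).
have pE e : p.[e] = \prod_i (u i + e).
  by rewrite horner_prod; apply: eq_bigr => i _; rewrite !hornerE.
have p0 : p.[0] < y by rewrite pE; under eq_bigr do rewrite addr0.
have /nbhs_ballP[d /= d0 dP] : \forall e \near (0 : R), p.[e] < y.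
  exact: (cvgr_lt _ (@continuous_horner _ p 0) _ p0).
exists d => // e /andP[e0 ed]; rewrite -pE; apply: dP.
by rewrite /ball/= sub0r normrN ger0_norm.
Qed.

Lemma bounded_set_coord (R : realType) n (D : set 'cV[R]_n) : bounded_set D ->
  exists2 r, 0 <= r & forall x i, D x -> `|x i 0| <= r.
Proof.
move=> [r [_ rP]]; exists (`|r| + 1) => [|x i Dx]; first by rewrite addr_ge0.
have xr : `|x| <= `|r| + 1.
  by apply: rP => //; rewrite (le_lt_trans (ler_norm r))// ltrDl.
apply: le_trans xr; rewrite [`|x|]mx_normrE.
exact: (le_bigmax _ (fun ij => `|x ij.1 ij.2|) (i, 0)).
Qed.

(** * Averaging over the points of V in a large box *)

Section Translates.
Variables (R : realType) (n k : nat) (L : set 'cV[R]_n.+1).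
Variable v : 'I_k -> 'cV[R]_n.+1.
Hypothesis hL : lattice L.
Hypothesis hv : forall i j : 'I_k, (i < j)%N -> ~ L (v i - v j).

Lemma lattice_det_basis :
  exists2 B, lattice_basis L B & lattice_det L = `|\det B|.
Proof.
exists (xget 0 (lattice_basis L)) => //.
by have [B LB] := lattice_has_basis hL; exact: (xgetPex 0 (ex_intro _ B LB)).
Qed.

(** The cosets [v i + L] are disjoint by [hv], and the invertible [B] separates points within one
    coset. *)
Lemma translates_inj (B : 'M[R]_n.+1) (C : Type) (z : C -> 'cV[int]_n.+1) :
  lattice_basis L B -> injective z ->
  injective (fun x : 'I_k * C => v x.1 + B *m map_mx intr (z x.2)).
Proof.
move=> [uB LB] zinj [i c] [j d] /= e.
have Lij a b : L (B *m map_mx intr (z a) - B *m map_mx intr (z b)).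
  rewrite -mulmxBr -map_mxB LB.
  by exists (z a - z b).
have ij : i = j.
  apply/val_inj/eqP; case: ltngtP => // h; exfalso.
    apply: (hv h); have -> // : v i - v j =
      B *m map_mx intr (z d) - B *m map_mx intr (z c).
    by apply/eqP; rewrite subr_eq addrAC eq_sym subr_eq addrC -e addrC.
  apply: (hv h); have -> // : v j - v i =
    B *m map_mx intr (z c) - B *m map_mx intr (z d).
  by apply/eqP; rewrite subr_eq addrAC eq_sym subr_eq addrC e addrC.
move: e; rewrite ij => /addrI/(congr1 (mulmx (invmx B))); rewrite !mulKmx//.
move=> e; congr pair; apply: zinj; apply/colP => a.
by move/colP/(_ a): e; rewrite !mxE => /intr_inj.
Qed.

(* Each point of V in a large box gives one translate of D1 and one of D2
   contained in a box K that is only slightly larger; if every point was covered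
   at most [l] times, the volume of K would contradict the hypothesis on the
   volumes. *)
Lemma exists_dense_translate (l : nat) (D1 D2 : set 'cV[R]_n.+1)
    (t : 'cV[R]_n.+1) :
  (0 < k)%N -> (0 < l)%N ->
  bounded_set D1 -> Lebesgue_measurable D1 ->
  bounded_set D2 -> Lebesgue_measurable D2 ->
  (vol D1 + vol D2 > (lattice_det L / k%:R * l%:R)%:E)%E ->
  exists (J : finType) (p : J -> 'cV[R]_n.+1) (w : 'cV[R]_n.+1),
  [/\ injective p, forall j, (\bigcup_(i : 'I_k) translate (v i) L) (p j) &
    (l < #|[pred j | `[< D1 (w + (p j - t))%R >]]| +
         #|[pred j | `[< D2 (w + p j)%R >]]|)%N].
Proof.
move=> k0 l0 hb1 mD1 hb2 mD2 hvol.
apply: contrapT => noJ.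
have [B LB detB] := lattice_det_basis.
have [s [u [K [u0 detBu K0 count]]]] := lattice_points_box LB.1.
have [r1 r10 r1P] := bounded_set_coord hb1.
have [r2 r20 r2P] := bounded_set_coord hb2.
pose rt := \sum_i `|t i 0|.
pose rv := \sum_i \sum_j `|v i j 0|.
have rt0 : 0 <= rt by exact: sumr_ge0.
have rv0 : 0 <= rv by apply: sumr_ge0 => i _; exact: sumr_ge0.
have rtP i : `|t i 0| <= rt.
  by rewrite /rt (bigD1 i)//= lerDl; exact: sumr_ge0.
have rvP i j : `|v i j 0| <= rv.
  rewrite /rv (bigD1 i)//= (bigD1 j)//= -addrA lerDl.
  by rewrite addr_ge0// ?sumr_ge0// => ? _; exact: sumr_ge0.
(* [K'] collects the error [K], the radii of [D1] and [D2] and bounds for [t] and the [v i]; the 1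
   makes it positive. *)
pose K' := K + (r1 + r2 + rt + rv + 1).
have K'0 : 0 < K' by rewrite /K'; lra.
have bnd M : (0 < M)%N ->
    (k%:R%:E * (vol D1 + vol D2) <=
     (l%:R * \prod_i (u i + 3 * K' / M%:R))%:E)%E.
  move=> M0; have [C [z [zinj cardC zP]]] := count M M0.
  pose J : finType := ('I_k * C)%type.
  pose p (x : J) := v x.1 + B *m map_mx intr (z x.2).
  have pinj : injective p := translates_inj LB zinj.
  have pV j : (\bigcup_(i : 'I_k) translate (v i) L) (p j).
    exists j.1 => //; exists (B *m map_mx intr (z j.2)) => //.
    by rewrite LB.2; exists (z j.2).
  (* The box must contain points of the form [x - p j], so the bounds of [zP] appear with opposite
     signs; the inverse of [s] undoes the row permutation. *)
  pose a : 'cV[R]_n.+1 :=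
    \col_j (let i := (s^-1)%g j in - (u i * M%:R ^+ i.+1 + K' * M%:R ^+ i)).
  pose b : 'cV[R]_n.+1 := \col_j (let i := (s^-1)%g j in 2 * K' * M%:R ^+ i).
  have M1 i : 1 <= M%:R ^+ i :> R by rewrite exprn_ege1// ler1n.
  have Mr0 : 0 < M%:R :> R by rewrite ltr0n.
  have ab i : a i 0 <= b i 0.
    rewrite !mxE; set j := (s^-1)%g i.
    apply: (@le_trans _ _ 0).
      by rewrite oppr_le0 addr_ge0// mulr_ge0// ?exprn_ge0// ltW.
    by rewrite !mulr_ge0 ?exprn_ge0// ltW.
  have inbox (x : 'cV[R]_n.+1) (y : J) :
      (forall i, `|x i 0| <= r1 + r2 + rt) -> box a b (x - p y).
    move=> xr i; rewrite in_itv/= !mxE -(permKV s i).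
    set j := (s^-1)%g i; rewrite permK.
    have := zP y.2 j; rewrite mxE => /andP[z1 z2].
    have := xr (s j); rewrite ler_norml => /andP[x1 x2].
    have := rvP y.1 (s j); rewrite ler_norml => /andP[v1 v2].
    set q := \sum_(_ | _) _ in z1 z2 *.
    have E1 : K' * M%:R ^+ j =
        K * M%:R ^+ j + (r1 + r2 + rt + rv + 1) * M%:R ^+ j.
      by rewrite /K' mulrDl.
    have E2 : r1 + r2 + rt + rv + 1 <= (r1 + r2 + rt + rv + 1) * M%:R ^+ j.
      by rewrite ler_peMr//; lra.
    have E3 : 0 < K' * M%:R ^+ j by rewrite mulr_gt0// exprn_gt0.
    rewrite /=; apply/andP; split; lra.
  have D1box j w : D1 (w + (p j - t)) -> box a b w.
    have {2}-> : w = w + (p j - t) + t - p j by rewrite addrA subrK addrK.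
    move: (w + _) => y Dy.
    apply: inbox => i; have := r1P _ i Dy; have := rtP i.
    have := ler_normD (y i 0) (t i 0); rewrite [(y + t) i 0]mxE; lra.
  have D2box j w : D2 (w + p j) -> box a b w.
    move=> Dw; have -> : w = (w + p j) - p j by rewrite addrK.
    by apply: inbox => i; have := r2P _ i Dw; lra.
  have le_l w : (#|[pred j | `[< D1 (w + (p j - t))%R >]]| +
      #|[pred j | `[< D2 (w + p j)%R >]]| <= l)%N.
    rewrite leqNgt; apply/negP => h; apply: noJ.
    by exists J, p, w.
  have := packing_bound mD1 mD2 ab D1box D2box le_l.
  (* Taking M^(i+1) out of each side u_i M^(i+1) + 3 K' M^i leaves u_i + 3 K' / M. The product of
     the factors taken out equals [#|C|] and cancels below. *)
  have -> : box_volume a b =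
      (\prod_(i < n.+1) M ^ i.+1)%:R * \prod_i (u i + 3 * K' / M%:R).
    rewrite /box_volume (reindex_inj (@perm_inj _ s)) natr_prod -big_split/=.
    apply: eq_bigr => i _; rewrite !mxE permK natrX /= !exprS.
    by field; rewrite gt_eqF.
  have -> : #|J|%:R = (k%:R : R) * (\prod_(i < n.+1) M ^ i.+1)%:R.
    by rewrite card_prod card_ord cardC natrM.
  set m : R := (\prod_(i < n.+1) M ^ i.+1)%:R.
  have m0 : 0 < m by rewrite ltr0n prodn_gt0// => i; rewrite expn_gt0 M0.
  rewrite mulrCA !EFinM [(k%:R%:E * m%:E)%E]muleC -muleA.
  by rewrite lee_pmul2l// lte_fin.
have k0' : 0 < k%:R :> R by rewrite ltr0n.
have l0' : 0 < l%:R :> R by rewrite ltr0n.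
(* An infinite total volume already contradicts [bnd] at [M = 1]. *)
move: hvol bnd; case: (vol D1 + vol D2)%E => [S| |]//; last first.
  by move=> _ /(_ 1%N isT); rewrite gt0_muley ?lte_fin.
rewrite lte_fin detB -detBu => hvol bnd.
(* The strict volume hypothesis leaves a slack [d]; [M] is then taken large enough for 3 K' / M to
   be below [d]. *)
have /prodrD_lt[d d0 dP] : \prod_i u i < S * k%:R / l%:R.
  rewrite ltr_pdivlMr// mulrC; move: hvol.
  by rewrite mulrAC ltr_pdivrMr// mulrC.
pose M := (Num.truncn (3 * K' / d)).+1.
have Mr0 : 0 < M%:R :> R by rewrite ltr0n.
have /dP : 0 <= 3 * K' / M%:R < d.
  rewrite divr_ge0 ?mulr_ge0// ?ltW//= ltr_pdivrMr// [ltRHS]mulrC.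
  rewrite -ltr_pdivrMr//.
  exact: truncnS_gt.
have := bnd M isT; rewrite -EFinM lee_fin => h.
rewrite ltr_pdivlMr// mulrC [S * _]mulrC => h'.
by have := le_lt_trans h h'; rewrite ltxx.
Qed.

End Translates.

(** * From a dense translate to the difference set *)

Theorem theorem2p6 (R : realType) (n k l : nat) (hn : (0 < n)%N)
    (hk : (0 < k)%N) (L : set 'cV[R]_n) (hL : lattice L)
    (v : 'I_k -> 'cV[R]_n) (hv : forall i j : 'I_k, (i < j)%N -> ~ L (v i - v j))
    (V : set 'cV[R]_n) (hV : V = \bigcup_(i : 'I_k) translate (v i) L)
    (D1 D2 : set 'cV[R]_n)
    (hb1 : bounded_set D1) (hm1 : Lebesgue_measurable D1)
    (hb2 : bounded_set D2) (hm2 : Lebesgue_measurable D2)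
    (hvol : (vol D1 + vol D2 > (lattice_det L / k%:R * l%:R)%:E)%E)
    (hc1 : forall z, (translate z D1 `&` V #<= `I_l)%card)
    (hc2 : forall z, (translate z D2 `&` V #<= `I_l)%card) :
  forall t, (`I_l #<= translate t (diffset D1 D2) `&` diffset V V)%card.
Proof.
case: n hn => // n _ in L hL v hv V hV D1 D2 hb1 hm1 hb2 hm2 hvol hc1 hc2 *.
(* The case [l = 0] is split off because the averaging divides by [l]. *)
move=> t; have [->|l0] := posnP l; first by rewrite II0 card_ge0.
have [J [p [w [pinj pV lt_l]]]] :=
  exists_dense_translate hL hv t hk l0 hb1 hm1 hb2 hm2 hvol.
set A := [pred j | _] in lt_l; set B := [pred j | `[< D2 _ >]] in lt_l.
have card_le (P : pred J) (S : set 'cV[R]_n.+1) :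
    (S `&` V #<= `I_l)%card -> (forall j, j \in P -> S (p j)) -> (#|P| <= l)%N.
  move=> Sl PS; rewrite cardE -(size_map p); apply: card_le_uniq Sl.
    by rewrite map_inj_uniq// enum_uniq.
  move=> _ /mapP[j + ->]; rewrite mem_enum => jP.
  by split; [exact: PS | rewrite hV; exact: pV].
(* That [w + (p j - t)] is in [D1] means that [p j] is in the translate of [D1] by [t - w]; for [D2]
   the translation is by [- w]. *)
have Al : (#|A| <= l)%N.
  apply: card_le (hc1 (t - w)) _ => j /asboolW Dj.
  by exists (w + (p j - t)) => //; apply/colP => i; rewrite !mxE; ring.
have Bl : (#|B| <= l)%N.
  apply: card_le (hc2 (- w)) _ => j /asboolW Dj.
  by exists (w + p j) => //; rewrite addKr.
apply: (@card_diff_ge _ _ J p A B _ _ pinj _ _ _ lt_l).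
- move=> i j /asboolW Di /asboolW Dj; split.
    exists (w + (p i - t) - (w + p j)).
      by exists (w + (p i - t)) => //; exists (w + p j).
    by apply/colP => a; rewrite !mxE; ring.
  by exists (p i); rewrite ?hV//; exists (p j).
- by rewrite lt0n; apply: contraTneq lt_l => ->; rewrite add0n -leqNgt.
- by rewrite lt0n; apply: contraTneq lt_l => ->; rewrite addn0 -leqNgt.
Qed.
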